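(* Let $q\in\mathbb{C}$, $q\ne 0$, be not a root of unity, let $\omega\in\{1,-1\}$ and $k\in\frac12\mathbb{N}_0$, and let $(T_{\omega,k},V_k)$ be the irreducible finite-dimensional $U_q(\mathfrak{sl}_2)$-module on $V_k=\langle v_{-k},v_{-k+1},\dots,v_k\rangle$ defined in the context. Its Dirac cohomology is $$H_D(T_{\omega,k})=\mathbb{C}\,v_{-k}\otimes s_{-1}\ \oplus\ \mathbb{C}\,v_k\otimes s_1$$ (that is, the classes of $v_{-k}\otimes s_{-1}$ and $v_k\otimes s_1$ form a basis of it). The $U_q(\mathfrak{k})$-action on $H_D(T_{\omega,k})$ is given by $$K(v_{-k}\otimes s_{-1})=\omega q^{-2k-1}\,v_{-k}\otimes s_{-1},\qquad K(v_k\otimes s_1)=\omega q^{2k+1}\,v_k\otimes s_1.$$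
   Context: $U_q(\mathfrak{sl}_2)$ is the associative unital $\mathbb{C}$-algebra generated by $K,K^{-1},E,F$ with relations $KK^{-1}=K^{-1}K=1$, $KE=q^2EK$, $KF=q^{-2}FK$, $EF-FE=\frac{K-K^{-1}}{q-q^{-1}}$. $C(\mathfrak{p})$ is the associative unital $\mathbb{C}$-algebra generated by $c(E_0),c(F_0)$ with relations $c(E_0)^2=0$, $c(F_0)^2=0$, $c(E_0)c(F_0)+c(F_0)c(E_0)=1$. Its spin module is $S=\mathbb{C}s_{-1}\oplus\mathbb{C}s_1$ with $c(E_0)s_{-1}=s_1$, $c(E_0)s_1=0$, $c(F_0)s_{-1}=0$, $c(F_0)s_1=s_{-1}$. For a $U_q(\mathfrak{sl}_2)$-module $M$, the algebra $U_q(\mathfrak{sl}_2)\otimes C(\mathfrak{p})$ acts on $M\otimes S$ by $(u\otimes a)(m\otimes s)=um\otimes as$. The Dirac operator is $D=E\otimes c(F_0)+F\otimes c(E_0)$, and the Dirac cohomology of $M$ is $H_D(M)=\ker(D)/(\operatorname{im}(D)\cap\ker(D))$, for $D$ acting on $M\otimes S$. $U_q(\mathfrak{k})=\mathbb{C}[K,K^{-1}]$ acts on $M\otimes S$, and on $H_D(M)$, through the diagonal embedding $\delta:U_q(\mathfrak{k})\to U_q(\mathfrak{sl}_2)\otimes C(\mathfrak{p})$, $\delta(K)=K\otimes\alpha(K)$, $\alpha(K)=q^{-1}+(q-q^{-1})c(E_0)c(F_0)$ (so $\alpha(K)s_{\pm1}=q^{\pm1}s_{\pm1}$); here ''$K(\cdot)$''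 means the action of $\delta(K)$. The module $T_{\omega,k}$: $V_k$ is the complex vector space with basis $v_{-k},v_{-k+1},\dots,v_k$ (dimension $2k+1$), $v_{-k-1}=v_{k+1}=0$, and $$T_{\omega,k}(K)v_m=\omega q^{2m}v_m,\quad T_{\omega,k}(E)v_m=\sqrt{[k-m][k+m+1]}\,v_{m+1},\quad T_{\omega,k}(F)v_m=\omega\sqrt{[k+m][k-m+1]}\,v_{m-1}$$ for $m\in\{-k,-k+1,\dots,k\}$, where $[n]=\frac{q^n-q^{-n}}{q-q^{-1}}$ and the square root is chosen with argument in $[0,\pi)$. *)

(* Defs.v *)
From HB Require Import structures.
From mathcomp Require Import all_boot all_order all_algebra.
From mathcomp Require Import generic_quotient ring_quotient.
From mathcomp Require Import ring zify boolp.

Set Implicit Arguments.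
Unset Strict Implicit.
Unset Printing Implicit Defensive.

Import GRing.Theory Num.Theory.
Local Open Scope ring_scope.
Local Open Scope quotient_scope.

(* Associative unital algebras presented by generators and relations: formal  *)
(* algebra terms modulo the smallest congruence that satisfies the algebra    *)
(* axioms and contains the relations.                                         *)
Inductive aterm (F I : Type) : Type :=
| Gen of I
| Cst of F
| Add of aterm F I & aterm F I
| Mul of aterm F I & aterm F I.
Arguments Gen {F I}.
Arguments Cst {F I}.

HB.instance Definition _ (F I : Type) := gen_eqMixin (aterm F I).
HB.instance Definition _ (F I : Type) := gen_choiceMixin (aterm F I).

Declare Scope aterm_scope.
Delimit Scope aterm_scope with A.
Bind Scope aterm_scope with aterm.
Notation "t + u" := (Add t u) : aterm_scope.
Notation "t * u" := (Mul t u) : aterm_scope.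
Notation "c %:C" := (Cst c) (format "c %:C") : aterm_scope.
Notation "t - u" := (Add t (Mul (Cst (-1)%R) u)) : aterm_scope.
Notation "1" := (Cst 1%R) : aterm_scope.
Notation "0" := (Cst 0%R) : aterm_scope.

Section Presented.
Variables (F : fieldType) (I : Type).
Local Notation T := (aterm F I).

Inductive cong (R : T -> T -> Prop) : T -> T -> Prop :=
| cong_rel t u : R t u -> cong R t u
| cong_refl t : cong R t t
| cong_sym t u : cong R t u -> cong R u t
| cong_trans t u v : cong R t u -> cong R u v -> cong R t v
| cong_add t t' u u' : cong R t t' -> cong R u u' -> cong R (t + u) (t' + u')
| cong_mul t t' u u' : cong R t t' -> cong R u u' -> cong R (t * u) (t' * u')
| cong_addA t u v : cong R (t + (u + v)) (t + u + v)
| cong_addC t u : cong R (t + u) (u + t)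
| cong_add0 t : cong R (0 + t) t
| cong_addN t : cong R ((-1)%R%:C * t + t) 0
| cong_mulA t u v : cong R (t * (u * v)) (t * u * v)
| cong_mul1 t : cong R (1 * t) t
| cong_mulDl t u v : cong R ((t + u) * v) (t * v + u * v)
| cong_mulDr t u v : cong R (t * (u + v)) (t * u + t * v)
| cong_cstD a b : cong R (a + b)%R%:C (a%:C + b%:C)
| cong_cstM a b : cong R (a * b)%R%:C (a%:C * b%:C)
| cong_cstC a t : cong R (a%:C * t) (t * a%:C).

Variable R : T -> T -> Prop.

Definition congb : rel T := fun t u => `[< cong R t u >].

Lemma congb_equiv : equiv_class_of congb.
Proof.
split=> [t|t u|u t v]; first by apply/asboolP; apply: cong_refl.
  by apply/asboolP/asboolP; apply: cong_sym.
by move=> /asboolP h1 /asboolP h2; apply/asboolP; apply: cong_trans h1 h2.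
Qed.

Canonical congb_equivrel := EquivRelPack congb_equiv.
Canonical congb_encModRel := defaultEncModRel congb.

Definition presented := {eq_quot congb}.
HB.instance Definition _ := Choice.on presented.
HB.instance Definition _ : EqQuotient T congb presented :=
  EqQuotient.on presented.

Definition pcls (t : T) : presented := \pi_presented t.
Definition gen (i : I) : presented := pcls (Gen i).

Lemma pclsP t u : cong R t u <-> pcls t = pcls u.
Proof.
split=> [h|/eqmodP/asboolP //].
by apply/eqmodP; apply/asboolP.
Qed.

Lemma pcls_repr x : pcls (repr x) = x.
Proof. exact: reprK. Qed.

Lemma pcls_ind (P : presented -> Prop) : (forall t, P (pcls t)) -> forall x, P x.
Proof. by move=> h x; rewrite -(pcls_repr x). Qed.

Definition padd (x y : presented) := pcls (repr x + repr y).
Definition pmul (x y : presented) := pcls (repr x * repr y).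
Definition popp (x : presented) := pcls ((-1)%R%:C * repr x).
Definition pscale (a : F) (x : presented) := pcls (a%:C * repr x).

Lemma cong_repr t : cong R (repr (pcls t)) t.
Proof. by apply/pclsP; rewrite pcls_repr. Qed.

Lemma paddE t u : padd (pcls t) (pcls u) = pcls (t + u).
Proof. by apply/pclsP; apply: cong_add; apply: cong_repr. Qed.
Lemma pmulE t u : pmul (pcls t) (pcls u) = pcls (t * u).
Proof. by apply/pclsP; apply: cong_mul; apply: cong_repr. Qed.
Lemma poppE t : popp (pcls t) = pcls ((-1)%R%:C * t).
Proof.
by apply/pclsP; apply: cong_mul; [apply: cong_refl | apply: cong_repr].
Qed.
Lemma pscaleE a t : pscale a (pcls t) = pcls (a%:C * t).
Proof.
by apply/pclsP; apply: cong_mul; [apply: cong_refl | apply: cong_repr].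
Qed.

Fact paddA : associative padd.
Proof.
elim/pcls_ind=> t; elim/pcls_ind=> u; elim/pcls_ind=> v.
by rewrite !paddE; apply/pclsP; apply: cong_addA.
Qed.
Fact paddC : commutative padd.
Proof.
elim/pcls_ind=> t; elim/pcls_ind=> u.
by rewrite !paddE; apply/pclsP; apply: cong_addC.
Qed.
Fact padd0 : left_id (pcls 0) padd.
Proof. by elim/pcls_ind=> t; rewrite paddE; apply/pclsP; apply: cong_add0. Qed.
Fact paddN : left_inverse (pcls 0) popp padd.
Proof.
by elim/pcls_ind=> t; rewrite poppE paddE; apply/pclsP; apply: cong_addN.
Qed.

HB.instance Definition _ :=
  GRing.isZmodule.Build presented paddA paddC padd0 paddN.

Fact pmulA : associative pmul.
Proof.
elim/pcls_ind=> t; elim/pcls_ind=> u; elim/pcls_ind=> v.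
by rewrite !pmulE; apply/pclsP; apply: cong_mulA.
Qed.
Fact pmul1 : left_id (pcls 1) pmul.
Proof. by elim/pcls_ind=> t; rewrite pmulE; apply/pclsP; apply: cong_mul1. Qed.
Fact pmulr1 : right_id (pcls 1) pmul.
Proof.
elim/pcls_ind=> t; rewrite pmulE; apply/pclsP.
by apply: cong_trans (cong_mul1 _ t); apply: cong_sym; apply: cong_cstC.
Qed.
Fact pmulDl : left_distributive pmul padd.
Proof.
elim/pcls_ind=> t; elim/pcls_ind=> u; elim/pcls_ind=> v.
by rewrite !(paddE, pmulE); apply/pclsP; apply: cong_mulDl.
Qed.
Fact pmulDr : right_distributive pmul padd.
Proof.
elim/pcls_ind=> t; elim/pcls_ind=> u; elim/pcls_ind=> v.
by rewrite !(paddE, pmulE); apply/pclsP; apply: cong_mulDr.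
Qed.

HB.instance Definition _ := GRing.Zmodule_isPzRing.Build presented
  pmulA pmul1 pmulr1 pmulDl pmulDr.

Fact pscaleA a b x : pscale a (pscale b x) = pscale (a * b) x.
Proof.
elim/pcls_ind: x => t; rewrite !pscaleE; apply/pclsP.
apply: cong_trans (cong_mulA _ _ _ _) _.
by apply: cong_mul; [apply: cong_sym; apply: cong_cstM | apply: cong_refl].
Qed.
Fact pscale1 : left_id 1 pscale.
Proof. by elim/pcls_ind=> t; rewrite pscaleE; apply/pclsP; apply: cong_mul1. Qed.
Fact pscaleDr : right_distributive pscale +%R.
Proof.
move=> a; elim/pcls_ind=> t; elim/pcls_ind=> u.
by rewrite /GRing.add /= !(paddE, pscaleE); apply/pclsP; apply: cong_mulDr.
Qed.
Fact pscaleDl x : {morph pscale^~ x : a b / a + b}.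
Proof.
move=> a b; elim/pcls_ind: x => t.
rewrite /GRing.add /= !(paddE, pscaleE); apply/pclsP.
apply: cong_trans (cong_mulDl _ _ _ _).
by apply: cong_mul; [apply: cong_cstD | apply: cong_refl].
Qed.

HB.instance Definition _ := GRing.Zmodule_isLmodule.Build F presented
  pscaleA pscale1 pscaleDr pscaleDl.

Lemma pclsD t u : pcls (t + u) = pcls t + pcls u.
Proof. by rewrite -paddE. Qed.
Lemma pclsM t u : pcls (t * u) = pcls t * pcls u.
Proof. by rewrite -pmulE. Qed.
Lemma pclsC a : pcls a%:C = a *: (1 : presented).
Proof.
rewrite [a *: _](pscaleE a); apply/pclsP; apply: cong_sym.
by apply: cong_trans (cong_cstC _ _ _) (cong_mul1 _ _).
Qed.
Lemma pclsZ a t : pcls (a%:C * t) = a *: pcls t.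
Proof. by rewrite -pscaleE. Qed.

Fact pres_scalerAl (a : F) (x y : presented) : a *: (x * y) = a *: x * y.
Proof.
elim/pcls_ind: x => t; elim/pcls_ind: y => u.
by rewrite -!(pclsZ, pclsM); apply/pclsP; apply: cong_mulA.
Qed.
Fact pres_scalerAr (a : F) (x y : presented) : a *: (x * y) = x * (a *: y).
Proof.
rewrite pres_scalerAl; elim/pcls_ind: x => t; elim/pcls_ind: y => u.
rewrite -!(pclsZ, pclsM); apply/pclsP.
apply: (@cong_trans _ _ (t * a%:C * u)%A).
  by apply: cong_mul; [apply: cong_cstC | apply: cong_refl].
by apply: cong_sym; apply: cong_mulA.
Qed.

End Presented.

Lemma cong_gen (F : fieldType) I (R : aterm F I -> aterm F I -> Prop) t u :
  R t u -> pcls R t = pcls R u.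
Proof. by move=> h; apply/pclsP; apply: cong_rel. Qed.

Section Lift.
Variables (F : fieldType) (I J : Type).
Variables (R : aterm F I -> aterm F I -> Prop).
Variables (R' : aterm F J -> aterm F J -> Prop).
Variable f : I -> presented R'.

Fixpoint aeval (t : aterm F I) : presented R' :=
  match t with
  | Gen i => f i
  | Cst a => a *: (1 : presented R')
  | Add t u => aeval t + aeval u
  | Mul t u => aeval t * aeval u
  end.

(* The algebra morphism sending [gen i] to [f i]; meaningful when [f]         *)
(* satisfies the relations [R] (lemma [liftE]).                               *)
Definition alg_lift (x : presented R) : presented R' := aeval (repr x).

Hypothesis fR : forall t u, R t u -> aeval t = aeval u.

Lemma aeval_cong t u : cong R t u -> aeval t = aeval u.
Proof.
elim=> //=.
- by move=> ? ? ? _ -> _ ->.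
- by move=> ? ? ? ? _ -> _ ->.
- by move=> ? ? ? ? _ -> _ ->.
- by move=> *; rewrite addrA.
- by move=> *; rewrite addrC.
- by move=> ?; rewrite scale0r add0r.
- by move=> ?; rewrite -pres_scalerAl mul1r scaleN1r addNr scale0r.
- by move=> *; rewrite mulrA.
- by move=> ?; rewrite scale1r mul1r.
- by move=> *; rewrite mulrDl.
- by move=> *; rewrite mulrDr.
- by move=> *; rewrite scalerDl.
- by move=> *; rewrite -pres_scalerAl mul1r scalerA.
- by move=> *; rewrite -pres_scalerAl mul1r -pres_scalerAr mulr1.
Qed.

Lemma liftE t : alg_lift (pcls R t) = aeval t.
Proof. exact/aeval_cong/cong_repr. Qed.
Lemma lift_gen i : alg_lift (gen R i) = f i.
Proof. exact: liftE. Qed.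
Lemma liftD x y : alg_lift (x + y) = alg_lift x + alg_lift y.
Proof.
by elim/pcls_ind: x => t; elim/pcls_ind: y => u; rewrite -pclsD !liftE.
Qed.
Lemma liftM x y : alg_lift (x * y) = alg_lift x * alg_lift y.
Proof.
by elim/pcls_ind: x => t; elim/pcls_ind: y => u; rewrite -pclsM !liftE.
Qed.
Lemma liftZ a x : alg_lift (a *: x) = a *: alg_lift x.
Proof.
elim/pcls_ind: x => t; rewrite -pclsZ !liftE /=.
by rewrite -pres_scalerAl mul1r.
Qed.
Lemma lift1 : alg_lift 1 = 1.
Proof. by rewrite -[1 in LHS](scale1r (1 : presented R)) -pclsC liftE /= scale1r. Qed.

End Lift.

(* Left modules over a presented algebra A.                                   *)
Record algModule (F : fieldType) I (R : aterm F I -> aterm F I -> Prop) :=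
  AlgModule {
    carrier :> lmodType F;
    act : presented R -> carrier -> carrier;
    act_linearl : forall m, linear (act^~ m);
    act_linearr : forall a, linear (act a);
    act1 : forall m, act 1 m = m;
    actM : forall a b m, act (a * b) m = act a (act b m)
  }.
Arguments AlgModule {F I R}.
Arguments act {F I R} : simpl never.

Section ActTheory.
Variables (F : fieldType) (I : Type) (R : aterm F I -> aterm F I -> Prop).
Variable M : algModule R.
HB.instance Definition _ a := GRing.isLinear.Build F M M *:%R (act M a)
  (act_linearr a).
Lemma actDl a b m : act M (a + b) m = act M a m + act M b m.
Proof. by have := act_linearl m 1 a b; rewrite !scale1r. Qed.
Lemma act0l m : act M 0 m = 0.
Proof. by apply: (addrI (act M 0 m)); rewrite -actDl !addr0. Qed.
Lemma actZl c a m : act M (c *: a) m = c *: act M a m.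
Proof. by have := act_linearl m c a 0; rewrite act0l !addr0. Qed.
End ActTheory.

(* The module over a presented algebra defined by the action of its           *)
(* generators.                                                                *)
Section GenModule.
Variables (F : fieldType) (I : Type) (R : aterm F I -> aterm F I -> Prop).
Variables (V : lmodType F) (f : I -> V -> V).

Fixpoint meval (t : aterm F I) (x : V) : V :=
  match t with
  | Gen i => f i x
  | Cst a => a *: x
  | Add t u => meval t x + meval u x
  | Mul t u => meval t (meval u x)
  end.

Hypothesis f_linear : forall i, linear (f i).
Hypothesis fR : forall t u, R t u -> meval t =1 meval u.

Lemma meval_linear t : linear (meval t).
Proof.
elim: t => [i|a|t iht u ihu|t iht u ihu] c x y /=; first exact: f_linear.
- by rewrite scalerDr !scalerA mulrC.
- by rewrite iht ihu scalerDr addrACA.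
- by rewrite ihu iht.
Qed.

HB.instance Definition _ t :=
  GRing.isLinear.Build F V V *:%R (meval t) (meval_linear t).

Lemma meval_sum t (J : finType) (c : J -> F) (b : J -> V) :
  meval t (\sum_j c j *: b j) = \sum_j c j *: meval t (b j).
Proof. by rewrite linear_sum; apply: eq_bigr => j _; rewrite linearZ_LR. Qed.

Lemma meval_cong t u : cong R t u -> meval t =1 meval u.
Proof.
elim=> //=.
- by move=> ? ? _ h x; rewrite h.
- by move=> ? ? ? _ h1 _ h2 x; rewrite h1 h2.
- by move=> ? ? ? ? _ h1 _ h2 x; rewrite h1 h2.
- by move=> ? ? ? ? _ h1 _ h2 x; rewrite h2 h1.
- by move=> * x; rewrite addrA.
- by move=> * x; rewrite addrC.
- by move=> * x; rewrite scale0r add0r.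
- by move=> * x; rewrite scaleN1r addNr scale0r.
- by move=> * x; rewrite scale1r.
- by move=> * x; rewrite linearD.
- by move=> * x; rewrite scalerDl.
- by move=> * x; rewrite scalerA.
- by move=> * x; rewrite linearZ.
Qed.

Definition gact (a : presented R) : V -> V := meval (repr a).

Lemma gactE t : gact (pcls R t) =1 meval t.
Proof. exact/meval_cong/cong_repr. Qed.

Fact gact_linearl x : linear (gact^~ x).
Proof.
move=> c; elim/pcls_ind=> t; elim/pcls_ind=> u /=.
by rewrite -pclsZ -pclsD !gactE.
Qed.
Fact gact_linearr a : linear (gact a).
Proof. exact: meval_linear. Qed.
Fact gact1 x : gact 1 x = x.
Proof. by rewrite -[1](scale1r (1 : presented R)) -pclsC gactE /= scale1r. Qed.
Fact gactM a b x : gact (a * b) x = gact a (gact b x).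
Proof.
by elim/pcls_ind: a => t; elim/pcls_ind: b => u; rewrite -pclsM !gactE.
Qed.

Definition genModule : algModule R :=
  AlgModule V gact gact_linearl gact_linearr gact1 gactM.

Lemma act_gen i x : act genModule (gen R i) x = f i x.
Proof. exact: gactE. Qed.

End GenModule.

(* The tensor product of the algebras A and B, presented by the generators    *)
(* (a, b), standing for the pure tensors, subject to bilinearity and to       *)
(* (a (x) b)(a' (x) b') = aa' (x) bb'.                                        *)
Section TensorAlgebra.
Variables (F : fieldType) (I J : Type).
Variables (R : aterm F I -> aterm F I -> Prop).
Variables (R' : aterm F J -> aterm F J -> Prop).
Local Notation A := (presented R).
Local Notation B := (presented R').
Local Notation g a b := (@Gen F (A * B)%type (a, b)).

Inductive tens_rel : aterm F (A * B)%type -> aterm F (A * B)%type -> Prop :=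
| tens_relDl a a' b : tens_rel (g (a + a')%R b) (g a b + g a' b)
| tens_relDr a b b' : tens_rel (g a (b + b')%R) (g a b + g a b')
| tens_relZl (c : F) a b : tens_rel (g (c *: a) b) (c%:C * g a b)
| tens_relZr (c : F) a b : tens_rel (g a (c *: b)) (c%:C * g a b)
| tens_rel1 : tens_rel (g 1 1) 1
| tens_relM a a' b b' : tens_rel (g (a * a')%R (b * b')%R) (g a b * g a' b').

Definition tens_alg := presented tens_rel.
Definition tens (a : A) (b : B) : tens_alg := gen tens_rel (a, b).

Lemma tensDl a a' b : tens (a + a') b = tens a b + tens a' b.
Proof. by rewrite -pclsD; apply/cong_gen/tens_relDl. Qed.
Lemma tensDr a b b' : tens a (b + b') = tens a b + tens a b'.
Proof. by rewrite -pclsD; apply/cong_gen/tens_relDr. Qed.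
Lemma tensZl c a b : tens (c *: a) b = c *: tens a b.
Proof. by rewrite -pclsZ; apply/cong_gen/tens_relZl. Qed.
Lemma tensZr c a b : tens a (c *: b) = c *: tens a b.
Proof. by rewrite -pclsZ; apply/cong_gen/tens_relZr. Qed.
Lemma tens11 : tens 1 1 = 1.
Proof. by rewrite -[RHS](scale1r (1 : tens_alg)) -pclsC; apply/cong_gen/tens_rel1. Qed.
Lemma tensM a a' b b' : tens a b * tens a' b' = tens (a * a') (b * b').
Proof. by rewrite -pclsM; apply/esym/cong_gen/tens_relM. Qed.

End TensorAlgebra.

(* The homology ker d / (im d `&` ker d) of an endomorphism d.               *)
Section Homology.
Variables (F : fieldType) (V : lmodType F) (d : {linear V -> V}).

Definition ker_pred : {pred V} := fun x => d x == 0.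
Fact ker_closed : submod_closed ker_pred.
Proof.
split=> [|c x y]; rewrite !unfold_in ?linear0 // => /eqP hx /eqP hy.
by rewrite linearP hx hy scaler0 addr0.
Qed.
HB.instance Definition _ := GRing.isSubmodClosed.Build F V ker_pred ker_closed.

Definition kernel := {x : V | x \in ker_pred}.
HB.instance Definition _ := SubType.on kernel.
HB.instance Definition _ := Choice.on kernel.
HB.instance Definition _ := [SubChoice_isSubLmodule of kernel by <:].

Definition im_pred : {pred kernel} := fun x => `[< exists y, val x = d y >].
Fact im_closed : submod_closed im_pred.
Proof.
split=> [|c x y]; first by apply/asboolP; exists 0; rewrite !linear0.
move=> /asboolP[x' hx] /asboolP[y' hy]; apply/asboolP.
by exists (c *: x' + y'); rewrite !linearP /= -hx -hy.
Qed.
HB.instance Definition _ := GRing.isSubmodClosed.Build F kernel im_pred im_closed.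

Definition homology := Quotient.quot im_pred.
HB.instance Definition _ := GRing.Zmodule.on homology.
Definition hcls0 (x : kernel) : homology := \pi x.

Lemma hcls0_eq x y : (hcls0 x = hcls0 y) <-> exists z, val x - val y = d z.
Proof.
rewrite /hcls0; split.
  by move/eqP; rewrite -Quotient.idealrBE => /asboolP; rewrite linearB.
by move=> h; apply/eqP; rewrite -Quotient.idealrBE; apply/asboolP; rewrite linearB.
Qed.

Lemma hcls0D x y : hcls0 (x + y) = hcls0 x + hcls0 y.
Proof. by rewrite /hcls0 piE. Qed.

Definition hscale (c : F) (x : homology) : homology := hcls0 (c *: repr x).

Lemma hscaleE c x : hscale c (hcls0 x) = hcls0 (c *: x).
Proof.
apply/hcls0_eq.
have /hcls0_eq[z hz] : hcls0 (repr (hcls0 x)) = hcls0 x by exact: reprK.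
by exists (c *: z); rewrite [RHS]linearZ_LR -hz scalerBr.
Qed.

Lemma hcls0_ind (P : homology -> Prop) : (forall x, P (hcls0 x)) -> forall x, P x.
Proof. by move=> h x; rewrite -[x]reprK; apply: h. Qed.

Fact hscaleA a b x : hscale a (hscale b x) = hscale (a * b) x.
Proof. by elim/hcls0_ind: x => x; rewrite !hscaleE scalerA. Qed.
Fact hscale1 : left_id 1 hscale.
Proof. by elim/hcls0_ind=> x; rewrite hscaleE scale1r. Qed.
Fact hscaleDr : right_distributive hscale +%R.
Proof.
move=> a; elim/hcls0_ind=> x; elim/hcls0_ind=> y.
by rewrite -hcls0D !hscaleE scalerDr hcls0D.
Qed.
Fact hscaleDl x : {morph hscale^~ x : a b / a + b}.
Proof. by elim/hcls0_ind: x => x a b; rewrite !hscaleE scalerDl hcls0D. Qed.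

HB.instance Definition _ := GRing.Zmodule_isLmodule.Build F homology
  hscaleA hscale1 hscaleDr hscaleDl.

Lemma hcls0Z c x : hcls0 (c *: x) = c *: hcls0 x.
Proof. by rewrite -hscaleE. Qed.

Lemma ker_mem x : d x = 0 -> x \in ker_pred.
Proof. by move=> h; rewrite unfold_in h. Qed.

Lemma kerP (x : kernel) : d (val x) = 0.
Proof. exact/eqP/(valP x). Qed.

Definition hcls x (dx0 : d x = 0) : homology := hcls0 (Sub x (ker_mem dx0)).

Lemma hcls_repr x (dx0 : d x = 0) :
  exists z, val (repr (hcls dx0)) - x = d z.
Proof. exact: (iffLR (hcls0_eq _ _) (reprK (hcls dx0))). Qed.

Lemma hcls_eq x y (hx : d x = 0) (hy : d y = 0) :
  hcls hx = hcls hy <-> exists z, x - y = d z.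
Proof. exact: hcls0_eq. Qed.

Lemma hcls_ind (P : homology -> Prop) :
  (forall x (hx : d x = 0), P (hcls hx)) -> forall x, P x.
Proof.
move=> h; elim/hcls0_ind=> x.
suff -> : x = Sub (val x) (ker_mem (kerP x)) by exact: (h _ (kerP x)).
exact: val_inj.
Qed.

Lemma hclsP c x y (hx : d x = 0) (hy : d y = 0) (h : d (c *: x + y) = 0) :
  c *: hcls hx + hcls hy = hcls h.
Proof. by rewrite -hcls0Z -hcls0D; congr hcls0; apply: val_inj. Qed.

End Homology.

(* An A-action commuting with d descends to the homology of d.                *)
Section HomologyModule.
Variables (F : fieldType) (I : Type) (R : aterm F I -> aterm F I -> Prop).
Variables (M : algModule R) (d : {linear M -> M}).
Hypothesis comm : forall a x, act M a (d x) = d (act M a x).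

Fact act_cycle a x : d x = 0 -> d (act M a x) = 0.
Proof. by move=> hx; rewrite -comm hx linear0. Qed.

Definition hact (a : presented R) (x : homology d) : homology d :=
  hcls (act_cycle a (kerP (repr x))).

Lemma hactE a x (hx : d x = 0) (hax : d (act M a x) = 0) :
  hact a (hcls hx) = hcls hax.
Proof.
have [z hz] := hcls_repr hx.
by apply/hcls_eq; exists (act M a z); rewrite -comm -hz linearB.
Qed.

Fact hact_linearl x : linear (hact^~ x).
Proof.
elim/hcls_ind: x => x hx c a b /=.
rewrite !(hactE _ (act_cycle _ hx)).
have h : d (c *: act M a x + act M b x) = 0.
  by rewrite linearP !act_cycle // scaler0 addr0.
by rewrite (hclsP _ _ h); apply/hcls_eq; exists 0; rewrite act_linearl subrr linear0.
Qed.
Fact hact_linearr a : linear (hact a).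
Proof.
move=> c; elim/hcls_ind=> x hx; elim/hcls_ind=> y hy.
have h : d (c *: x + y) = 0 by rewrite linearP hx hy scaler0 addr0.
have h' : d (c *: act M a x + act M a y) = 0.
  by rewrite linearP !act_cycle // scaler0 addr0.
rewrite (hclsP _ _ h) !(hactE _ (act_cycle _ _)) (hclsP _ _ h').
by apply/hcls_eq; exists 0; rewrite linearP subrr linear0.
Qed.
Fact hact1 x : hact 1 x = x.
Proof.
elim/hcls_ind: x => x hx; rewrite (hactE _ (act_cycle _ _)).
by apply/hcls_eq; exists 0; rewrite act1 subrr linear0.
Qed.
Fact hactM a b x : hact (a * b) x = hact a (hact b x).
Proof.
elim/hcls_ind: x => x hx.
rewrite !(hactE _ (act_cycle _ hx)) (hactE _ (act_cycle _ (act_cycle _ hx))).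
by apply/hcls_eq; exists 0; rewrite actM subrr linear0.
Qed.

Definition homologyModule : algModule R :=
  AlgModule (homology d) hact hact_linearl hact_linearr hact1 hactM.

End HomologyModule.

Variant Uq_gen := uK | uKinv | uE | uF.
Variant Uk_gen := kK | kKinv.
(* cE and cF stand for c(E_0) and c(F_0). *)
Variant Cp_gen := cE | cF.

Section QuantumSl2.
Variables (F : fieldType) (q : F).

Local Notation K := (@Gen F _ uK).
Local Notation Kinv := (@Gen F _ uKinv).
Local Notation E := (@Gen F _ uE).
Local Notation f := (@Gen F _ uF).

Inductive Uq_rel : aterm F Uq_gen -> aterm F Uq_gen -> Prop :=
| Uq_KKinv : Uq_rel (K * Kinv) 1
| Uq_KinvK : Uq_rel (Kinv * K) 1
| Uq_KE : Uq_rel (K * E) ((q ^+ 2)%:C * E * K)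
| Uq_KF : Uq_rel (K * f) ((q ^- 2)%:C * f * K)
| Uq_EF : Uq_rel (E * f - f * E) ((q - q^-1)%R^-1%:C * (K - Kinv)).

Definition Uq := presented Uq_rel.

(* U_q(k) = F[K, K^-1] *)
Inductive Uk_rel : aterm F Uk_gen -> aterm F Uk_gen -> Prop :=
| Uk_KKinv : Uk_rel (Gen kK * Gen kKinv) 1
| Uk_KinvK : Uk_rel (Gen kKinv * Gen kK) 1.

Definition Uk := presented Uk_rel.

Inductive Cp_rel : aterm F Cp_gen -> aterm F Cp_gen -> Prop :=
| Cp_EE : Cp_rel (Gen cE * Gen cE) 0
| Cp_FF : Cp_rel (Gen cF * Gen cF) 0
| Cp_EF : Cp_rel (Gen cE * Gen cF + Gen cF * Gen cE) 1.

Definition Cp := presented Cp_rel.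
Definition cE0 : Cp := gen Cp_rel cE.
Definition cF0 : Cp := gen Cp_rel cF.

(* The spin module: a vector x stands for x(false) s_{-1} + x(true) s_1. *)
Definition spin := {ffun bool -> F^o}.
HB.instance Definition _ := GRing.Lmodule.on spin.
Definition spin_s (e : bool) : spin := [ffun b => (b == e)%:R].
Definition s_m1 : spin := spin_s false.
Definition s_p1 : spin := spin_s true.

Definition spin_act (g : Cp_gen) (x : spin) : spin :=
  match g with cE => x false *: s_p1 | cF => x true *: s_m1 end.

Fact spin_act_linear g : linear (spin_act g).
Proof. by move=> c x y; case: g; rewrite /spin_act !ffunE scalerDl scalerA. Qed.

Fact spin_act_rel t u : Cp_rel t u -> meval spin_act t =1 meval spin_act u.
Proof.
case=> x; apply/ffunP=> -[]; rewrite /= !ffunE /= ?eqxx.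
all: by rewrite ?scale0r ?scale1r ?scaler0 //= /GRing.scale /= ?(mulr0, mulr1, mul0r, mul1r, addr0, add0r).
Qed.

Definition spinModule : algModule Cp_rel :=
  genModule spin_act_linear spin_act_rel.

Definition UqCp := tens_alg Uq_rel Cp_rel.
Definition ten (u : Uq) (a : Cp) : UqCp := tens u a.

(* M (x) S; as S has the basis s_{-1}, s_1, its elements are uniquely of the  *)
(* form m (x) s_{-1} + m' (x) s_1, encoded by the function false |-> m,       *)
(* true |-> m'.                                                               *)
Section TensorSpin.
Variable M : algModule Uq_rel.

Definition MS := {ffun bool -> M}.
HB.instance Definition _ := GRing.Lmodule.on MS.
Definition tenS (m : M) (s : spin) : MS := [ffun b => s b *: m].

Lemma tenS_sum (x : MS) : x = \sum_b tenS (x b) (spin_s b).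
Proof.
apply/ffunP=> b; rewrite sum_ffunE big_bool /= !ffunE.
by case: b; rewrite /= !(scale0r, scale1r, addr0, add0r).
Qed.

Definition tenS_act (g : Uq * Cp) (x : MS) : MS :=
  \sum_b tenS (act M g.1 (x b)) (act spinModule g.2 (spin_s b)).

Fact tenS_linearl s : linear (tenS^~ s).
Proof.
by move=> c x y; apply/ffunP=> b; rewrite !ffunE scalerDr !scalerA mulrC.
Qed.
Fact tenS_linearr m : linear (tenS m).
Proof.
by move=> c x y; apply/ffunP=> b; rewrite !ffunE scalerDl scalerA.
Qed.

HB.instance Definition _ m :=
  GRing.isLinear.Build F spin MS *:%R (tenS m) (tenS_linearr m).

Fact tenS_act_linear g : linear (tenS_act g).
Proof.
move=> c x y; rewrite /tenS_act scaler_sumr -big_split /=.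
by apply: eq_bigr => b _; rewrite !ffunE linearP tenS_linearl.
Qed.

Lemma spin_sum (s : spin) : s = \sum_b s b *: spin_s b.
Proof.
apply/ffunP=> b; rewrite sum_ffunE big_bool /= !ffunE.
by case: b; rewrite /GRing.scale /= !(mulr0, mulr1, addr0, add0r).
Qed.

(* (u (x) a)(m (x) s) = um (x) as *)
Lemma tenS_actE g m s :
  tenS_act g (tenS m s) = tenS (act M g.1 m) (act spinModule g.2 s).
Proof.
rewrite /tenS_act {2}(spin_sum s) linear_sum linear_sum.
apply: eq_bigr => b _; rewrite ffunE !linearZ_LR.
by apply/ffunP=> e; rewrite !ffunE !scalerA mulrC.
Qed.

Fact tenS_act_rel t u :
  @tens_rel _ _ _ Uq_rel Cp_rel t u -> meval tenS_act t =1 meval tenS_act u.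
Proof.
have sumE (g : Uq * Cp) x :
  tenS_act g x = \sum_b tenS (act M g.1 (x b)) (act spinModule g.2 (spin_s b)).
  by [].
case=> [a a' b|a b b'|c a b|c a b||a a' b b'] x /=.
- rewrite -big_split /=; apply: eq_bigr => e _; rewrite actDl.
  by apply/ffunP=> i; rewrite !ffunE scalerDr.
- by rewrite -big_split /=; apply: eq_bigr => e _; rewrite actDl linearD.
- rewrite /tenS_act scaler_sumr; apply: eq_bigr => e _ /=; rewrite actZl.
  by apply/ffunP=> i; rewrite !ffunE !scalerA mulrC.
- rewrite /tenS_act scaler_sumr; apply: eq_bigr => e _ /=.
  by rewrite actZl linearZ_LR.
- rewrite scale1r [RHS]tenS_sum; apply: eq_bigr => e _ /=.
  by rewrite !act1.
- rewrite [in RHS](sumE (a', b')) /=.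
  have lin g : linear (tenS_act g) by exact: tenS_act_linear.
  pose L := GRing.isLinear.Build F MS MS *:%R (tenS_act (a, b)) (lin _).
  pose T : {linear MS -> MS} := HB.pack (tenS_act (a, b)) L.
  rewrite -[RHS]/(T _) linear_sum; apply: eq_bigr => e _.
  by rewrite /= tenS_actE /= !actM.
Qed.

Definition MSModule : algModule (@tens_rel _ _ _ Uq_rel Cp_rel) :=
  genModule tenS_act_linear tenS_act_rel.

Lemma MSModuleE u a m s :
  act MSModule (ten u a) (tenS m s) = tenS (act M u m) (act spinModule a s).
Proof. by rewrite act_gen tenS_actE. Qed.

End TensorSpin.

Definition gK : Uq := gen Uq_rel uK.
Definition gKinv : Uq := gen Uq_rel uKinv.
Definition gE : Uq := gen Uq_rel uE.
Definition gF : Uq := gen Uq_rel uF.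

Lemma gKKinv : gK * gKinv = 1.
Proof. by rewrite -pclsM (cong_gen Uq_KKinv) pclsC scale1r. Qed.
Lemma gKinvK : gKinv * gK = 1.
Proof. by rewrite -pclsM (cong_gen Uq_KinvK) pclsC scale1r. Qed.
Lemma gKE : gK * gE = q ^+ 2 *: (gE * gK).
Proof. by rewrite -pclsM (cong_gen Uq_KE) pclsM pclsZ -pres_scalerAl. Qed.
Lemma gKF : gK * gF = q ^- 2 *: (gF * gK).
Proof. by rewrite -pclsM (cong_gen Uq_KF) pclsM pclsZ -pres_scalerAl. Qed.

Lemma cEE : cE0 * cE0 = 0.
Proof. by rewrite -pclsM (cong_gen Cp_EE) pclsC scale0r. Qed.
Lemma cFF : cF0 * cF0 = 0.
Proof. by rewrite -pclsM (cong_gen Cp_FF) pclsC scale0r. Qed.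
Lemma cEF : cE0 * cF0 + cF0 * cE0 = 1.
Proof. by rewrite -!pclsM -pclsD (cong_gen Cp_EF) pclsC scale1r. Qed.

Definition Dirac : UqCp := ten gE cF0 + ten gF cE0.

Definition alphaK : Cp := q^-1 *: (1 : Cp) + (q - q^-1) *: (cE0 * cF0).
Definition alphaKinv : Cp := q *: (1 : Cp) + (q^-1 - q) *: (cE0 * cF0).

(* [alphaKinv] is the inverse of [alphaK], so that [delta] is an algebra      *)
(* morphism.                                                                  *)
Definition delta_gen (g : Uk_gen) : UqCp :=
  match g with kK => ten gK alphaK | kKinv => ten gKinv alphaKinv end.
Definition delta : Uk -> UqCp := alg_lift delta_gen.

Lemma cEFE : cE0 * cF0 * cE0 = cE0.
Proof.
by rewrite -mulrA -(addrK (cE0 * cF0) (cF0 * cE0)) [cF0 * _ + _]addrC cEF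
           mulrBr mulr1 mulrA cEE mul0r subr0.
Qed.
Lemma cFEF : cF0 * cE0 * cF0 = cF0.
Proof.
by rewrite -(addrK (cE0 * cF0) (cF0 * cE0)) [cF0 * _ + _]addrC cEF
           mulrBl mul1r -mulrA cFF mulr0 subr0.
Qed.

Hypothesis q0 : q != 0.

Lemma idem_mul (h : Cp) (a b c d : F) : h * h = h ->
  (a *: (1 : Cp) + b *: h) * (c *: (1 : Cp) + d *: h) =
  (a * c) *: (1 : Cp) + (a * d + b * c + b * d) *: h.
Proof.
move=> hh; rewrite mulrDl !mulrDr -!(pres_scalerAl, pres_scalerAr).
by rewrite !(mulr1, mul1r) hh !scalerA !scalerDl !addrA.
Qed.

Lemma cEF_idem : cE0 * cF0 * (cE0 * cF0) = cE0 * cF0.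
Proof. by rewrite mulrA cEFE. Qed.

Lemma alphaKV : alphaK * alphaKinv = 1.
Proof.
rewrite (idem_mul _ _ _ _ cEF_idem) mulVf // scale1r.
by rewrite [X in X *: (cE0 * cF0)](_ : _ = 0) ?scale0r ?addr0 //; field.
Qed.
Lemma alphaVK : alphaKinv * alphaK = 1.
Proof.
rewrite (idem_mul _ _ _ _ cEF_idem) mulfV // scale1r.
by rewrite [X in X *: (cE0 * cF0)](_ : _ = 0) ?scale0r ?addr0 //; field.
Qed.

Fact delta_rel t u : Uk_rel t u ->
  aeval delta_gen t = aeval delta_gen u.
Proof.
case=> /=; rewrite scale1r tensM ?gKKinv ?gKinvK ?alphaKV ?alphaVK;
  exact: tens11.
Qed.

Lemma deltaK : delta (gen Uk_rel kK) = ten gK alphaK.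
Proof. exact: (lift_gen delta_rel). Qed.
Lemma deltaKinv : delta (gen Uk_rel kKinv) = ten gKinv alphaKinv.
Proof. exact: (lift_gen delta_rel). Qed.

Lemma deltaK_Dirac : ten gK alphaK * Dirac = Dirac * ten gK alphaK.
Proof.
have aE : alphaK * cE0 = q *: cE0.
  rewrite /alphaK mulrDl -!pres_scalerAl mul1r cEFE -scalerDl; congr (_ *: _).
  by ring.
have aF : alphaK * cF0 = q^-1 *: cF0.
  by rewrite /alphaK mulrDl -!pres_scalerAl mul1r -mulrA cFF mulr0 scaler0 addr0.
have Ea : cE0 * alphaK = q^-1 *: cE0.
  by rewrite /alphaK mulrDr -!pres_scalerAr mulr1 mulrA cEE mul0r scaler0 addr0.
have Fa : cF0 * alphaK = q *: cF0.
  rewrite /alphaK mulrDr -!pres_scalerAr mulr1 mulrA cFEF -scalerDl.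
  by congr (_ *: _); ring.
rewrite /Dirac mulrDr mulrDl !tensM gKE gKF aE aF Ea Fa.
rewrite !(tensZl, tensZr) !scalerA; congr (_ *: _ + _ *: _); by field.
Qed.

Lemma delta_Dirac a : delta a * Dirac = Dirac * delta a.
Proof.
elim/pcls_ind: a => t; rewrite /delta (liftE delta_rel).
elim: t => [[]|c|t iht u ihu|t iht u ihu] /=.
- exact: deltaK_Dirac.
- have e1 : ten gKinv alphaKinv * ten gK alphaK = 1.
    by rewrite tensM gKinvK alphaVK tens11.
  have e2 : ten gK alphaK * ten gKinv alphaKinv = 1.
    by rewrite tensM gKKinv alphaKV tens11.
  rewrite -[LHS]mulr1 -e2 mulrA -[X in X * _]mulrA -deltaK_Dirac mulrA.
  by rewrite e1 mul1r.
- by rewrite -pres_scalerAl -pres_scalerAr mulr1 mul1r.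
- by rewrite [LHS]mulrDl [RHS]mulrDr iht ihu.
- by rewrite [RHS]mulrA -iht -[LHS]mulrA -[RHS]mulrA ihu.
Qed.

(* The restriction of M (x) S to U_q(k) along delta.                          *)
Section DiracCohomology.
Variable M : algModule Uq_rel.

Definition kact (a : Uk) : MSModule M -> MSModule M :=
  act (MSModule M) (delta a).

Fact kact_linearl x : linear (kact^~ x).
Proof.
by move=> c a b; rewrite /kact /delta (liftD delta_rel) (liftZ delta_rel) actDl actZl.
Qed.
Fact kact1 x : kact 1 x = x.
Proof. by rewrite /kact /delta (lift1 delta_rel) act1. Qed.
Fact kactM a b x : kact (a * b) x = kact a (kact b x).
Proof. by rewrite /kact /delta (liftM delta_rel) actM. Qed.

Definition kMSModule : algModule Uk_rel :=
  AlgModule (MSModule M) kact kact_linearl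
    (fun a => @act_linearr _ _ _ (MSModule M) (delta a)) kact1 kactM.

Definition DiracOp : MS M -> MS M := act (MSModule M) Dirac.
HB.instance Definition _ := GRing.isLinear.Build F (MS M) (MS M) *:%R DiracOp
  (@act_linearr _ _ _ (MSModule M) Dirac).

Fact kact_Dirac a x : act kMSModule a (DiracOp x) = DiracOp (act kMSModule a x).
Proof.
have e y : act kMSModule a y = act (MSModule M) (delta a) y by [].
by rewrite !e /DiracOp -!actM delta_Dirac.
Qed.

Definition HD : algModule Uk_rel :=
  @homologyModule _ _ _ kMSModule DiracOp kact_Dirac.

Lemma act_HD a x (h : DiracOp x = 0)
    (h' : DiracOp (act (MSModule M) (delta a) x) = 0) :
  act HD a (hcls h) = hcls h'.
Proof. exact: (@hactE _ _ _ kMSModule DiracOp kact_Dirac a x h h'). Qed.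

End DiracCohomology.
End QuantumSl2.

(* A finite basis, given as a family of vectors. *)
Definition is_basis (F : fieldType) (V : lmodType F) (J : finType) (b : J -> V) :=
  (forall c : J -> F, \sum_j c j *: b j = 0 -> forall j, c j = 0) /\
  (forall x, exists c : J -> F, x = \sum_j c j *: b j).

(* The module T_{w,k}, where n = 2k, so that dim V_k = n + 1. The basis       *)
(* vector v_m is indexed by the integer i = m + k, which runs through 0..n;   *)
(* thus 2m = 2i - n, k - m = n - i and k + m = i.                             *)
Section T.
Variables (C : numClosedFieldType) (q w : C) (n : nat).
Hypotheses (q0 : q != 0) (w1 : w = 1 \/ w = -1).

Definition qnum (x : int) : C := (q ^ x - q ^ (- x)) / (q - q^-1).

Definition Tspace := 'cV[C]_n.+1.
HB.instance Definition _ := GRing.Lmodule.on Tspace.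

(* zero unless 0 <= i <= n *)
Definition Tv (i : int) : Tspace := \col_(j < n.+1) ((j : int) == i)%:R.

(* The action of the generators on the basis; [sqrtC] is the square root with *)
(* argument in [0, pi[.                                                       *)
Definition Tgen (g : Uq_gen) (i : int) : Tspace :=
  match g with
  | uK => (w * q ^ (2 * i - n%:Z)) *: Tv i
  | uKinv => (w * q ^ (2 * i - n%:Z))^-1 *: Tv i
  | uE => sqrtC (qnum (n%:Z - i) * qnum (i + 1)) *: Tv (i + 1)
  | uF => (w * sqrtC (qnum i * qnum (n%:Z - i + 1))) *: Tv (i - 1)
  end.

Definition Top (g : Uq_gen) (x : Tspace) : Tspace :=
  \sum_(i < n.+1) x i 0 *: Tgen g i.

Fact Top_linear g : linear (Top g).
Proof.
move=> c x y; rewrite /Top scaler_sumr -big_split /=.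
by apply: eq_bigr => i _; rewrite !mxE scalerDl scalerA.
Qed.

HB.instance Definition _ g :=
  GRing.isLinear.Build C Tspace Tspace *:%R (Top g) (Top_linear g).

Lemma Tv_sum (x : Tspace) : x = \sum_(i < n.+1) x i 0 *: Tv i.
Proof.
apply/colP=> j; rewrite summxE (bigD1 j) //= big1 => [|i ij]; rewrite !mxE.
  by rewrite eqxx mulr1 addr0.
by rewrite eqz_nat (inj_eq val_inj) eq_sym (negPf ij) mulr0.
Qed.

Lemma Top_Tv g (i : 'I_n.+1) : Top g (Tv i) = Tgen g i.
Proof.
rewrite /Top (bigD1 i) //= big1 => [|j ij]; rewrite !mxE.
  by rewrite eqxx scale1r addr0.
by rewrite eqz_nat (inj_eq val_inj) (negPf ij) scale0r.
Qed.

Lemma Tv0 (i : int) : ~~ (0 <= i <= n%:Z) -> Tv i = 0.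
Proof.
move=> h; apply/colP=> j; rewrite !mxE; case: eqP => // e; move: h.
by rewrite -e !lez_nat /= -ltnS ltn_ord.
Qed.

Lemma qnum0 : qnum 0 = 0.
Proof. by rewrite /qnum oppr0 subrr mul0r. Qed.

Lemma Tgen0 g (i : int) : ~~ (0 <= i <= n%:Z) -> Top g (Tv i) = 0.
Proof. by move/Tv0 ->; rewrite linear0. Qed.

Lemma Top_TvE g (i : int) : Top g (Tv i) = Tgen g i.
Proof.
have [/andP[]|h] := boolP (0 <= i <= n%:Z).
  by case: i => // i _; rewrite lez_nat -ltnS => h; exact: (Top_Tv g (Ordinal h)).
rewrite Tgen0 //; case: g => /=; rewrite ?(Tv0 h) ?scaler0 //.
  have [->|h'] := eqVneq i (-1).
    by rewrite addNr qnum0 mulr0 rootC0 scale0r.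
  by rewrite Tv0 ?scaler0 //; lia.
have [->|h'] := eqVneq i (n%:Z + 1).
  by rewrite opprD addNKr addNr qnum0 mulr0 rootC0 mulr0 scale0r.
by rewrite Tv0 ?scaler0 //; lia.
Qed.

Lemma qnum_EF (i : int) :
  qnum i * qnum (n%:Z - i + 1) - qnum (n%:Z - i) * qnum (i + 1) =
  (q - q^-1)^-1 * (q ^ (2 * i - n%:Z) - (q ^ (2 * i - n%:Z))^-1).
Proof.
have [h|h] := eqVneq (q - q^-1) 0.
  by rewrite /qnum h invr0 !mulr0 mul0r subrr.
have qX (x : int) : q ^ x != 0 by rewrite expfz_neq0.
have q2 : q * q - 1 != 0.
  have e : q - q^-1 = (q * q - 1) / q by field.
  by apply: contra h; rewrite e => /eqP ->; rewrite mul0r.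
rewrite /qnum (_ : 2 * i - n%:Z = i - (n%:Z - i)); last by ring.
move: (n%:Z - i) => m.
rewrite !opprD !expfzDr // !exprN1 !expr1z -!invr_expz.
have := qX i; have := qX m; move: (q ^ i) (q ^ m) => a b b0 a0.
by field; rewrite a0 b0 q0 q2.
Qed.

Lemma TopZ g c x : Top g (c *: x) = c *: Top g x.
Proof. exact: linearZ_LR. Qed.

Fact Top_rel t u : Uq_rel q t u -> meval Top t =1 meval Top u.
Proof.
have w2 : w * w = 1 by case: w1 => ->; rewrite ?mulrNN mulr1.
have w0 : w != 0 by case: w1 => ->; rewrite ?oppr_eq0 oner_eq0.
have wV : w^-1 = w by apply: (mulfI w0); rewrite mulfV.
have qX (x : int) : q ^ x != 0 by rewrite expfz_neq0.
move=> r x; rewrite (Tv_sum x) !(meval_sum Top_linear).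
apply: eq_bigr => i _; congr (_ *: _); move: (Posz i) => {}i.
case: r => /=.
- rewrite Top_TvE /= TopZ /= Top_TvE /= scalerA mulVf ?scale1r //.
  by rewrite mulf_neq0.
- rewrite Top_TvE /= TopZ /= Top_TvE /= scalerA mulfV ?scale1r //.
  by rewrite mulf_neq0.
- rewrite !Top_TvE /= !TopZ /= !Top_TvE /= !scalerA; congr (_ *: _).
  rewrite (_ : 2 * (i + 1) - n%:Z = 2 * i - n%:Z + 2); last by ring.
  by rewrite expfzDr // -exprnP; ring.
- rewrite !Top_TvE /= !TopZ /= !Top_TvE /= !scalerA; congr (_ *: _).
  rewrite (_ : 2 * (i - 1) - n%:Z = 2 * i - n%:Z + (- 2)); last by ring.
  by rewrite expfzDr // exprnN; ring.
- rewrite !Top_TvE /= !TopZ /= !Top_TvE /= subrK addrK !scalerA.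
  rewrite -!scalerDl scalerA !mulN1r; congr (_ *: _).
  rewrite (_ : n%:Z - (i - 1) = n%:Z - i + 1); last by ring.
  rewrite (_ : n%:Z - (i + 1) + 1 = n%:Z - i); last by ring.
  rewrite [qnum (n%:Z - i + 1) * _]mulrC [qnum (i + 1) * _]mulrC invfM wV.
  rewrite -mulrBr [RHS]mulrCA -qnum_EF mulrBr.
  set A := _ * qnum (_ + 1); set B := _ * qnum (_ + 1).
  by rewrite -[A in RHS]sqrtCK -[B in RHS]sqrtCK; ring.
Qed.

Definition Tmodule : algModule (Uq_rel q) := genModule Top_linear Top_rel.

Lemma TmoduleE g i : act Tmodule (gen (Uq_rel q) g) (Tv i) = Tgen g i.
Proof. by rewrite act_gen Top_TvE. Qed.

End T.

Arguments tenS {F q} M m s.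
Arguments s_m1 {F}.
Arguments s_p1 {F}.
Arguments Tv {C}.

(* Main.v *)
Require Import Defs.
From mathcomp Require Import all_boot all_order all_algebra.
From mathcomp Require Import complex reals.
From mathcomp Require Import zify boolp.

Set Implicit Arguments.
Unset Strict Implicit.
Unset Printing Implicit Defensive.

Import GRing.Theory Num.Theory.
Local Open Scope ring_scope.
Local Open Scope complex_scope.

(** The Dirac operator only uses [E] and [F]: on [M (x) S], written as pairs
    [(x false, x true)] for [x false (x) s_m1 + x true (x) s_p1], it is
    [D x = (E (x true), F (x false))] (lemmas [DiracOp_m1], [DiracOp_p1]).
    So [ker D] is [ker F (x) s_m1 + ker E (x) s_p1], and [im D] is
    [im E (x) s_m1 + im F (x) s_p1], for every module [M].

    For [M = T_(w,k)] the operator [E] is a weighted shift up the weight basis.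
    Its weights are square roots of products of q-numbers [[i]] with [i]
    nonzero, except the last one, which is zero; as [q] is not a root of unity,
    such q-numbers do not vanish ([qnum_neq0]). Hence [ker E] is spanned by the
    highest weight vector ([Top_uE_ker]), whereas every vector of [im E] has
    coordinate zero on the lowest weight vector ([Top_uE_low]). The
    same holds for [F] with highest and lowest exchanged. Thus [ker D] is
    spanned by [v_{-k} (x) s_m1] and [v_k (x) s_p1], and meets [im D] only in
    zero, so the classes of these two vectors form a basis of the cohomology.

    Both vectors are tensor products of eigenvectors of [K] and of [alphaK], so
    [delta K] acts on them by the product of the eigenvalues ([HD_K_eigen]). *)

(** * Bases of homology spaces *)

Section HomologyBasis.
Variables (F : fieldType) (V : lmodType F) (d : {linear V -> V}).

Lemma cycleZ c x : d x = 0 -> d (c *: x) = 0.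
Proof. by move=> dx; rewrite linearZ_LR dx scaler0. Qed.

Lemma hclsZ c x (hx : d x = 0) (hcx : d (c *: x) = 0) :
  hcls hcx = c *: hcls hx.
Proof. by rewrite -[RHS]hcls0Z; congr hcls0; apply: val_inj. Qed.

Lemma hcls00 : hcls0 0 = 0 :> homology d.
Proof. by rewrite -[0 in LHS](scale0r 0) hcls0Z scale0r. Qed.

Lemma hcls_sum (J : finType) (c : J -> F) (b : J -> V)
    (hb : forall j, d (b j) = 0) (hs : d (\sum_j c j *: b j) = 0) :
  hcls hs = \sum_j c j *: hcls (hb j).
Proof.
pose u j : kernel d := Sub (b j) (ker_mem (hb j)).
have -> : hcls hs = hcls0 (\sum_j c j *: u j).
  congr hcls0; apply: val_inj; rewrite linear_sum.
  by apply: eq_bigr => j _; rewrite linearZ.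
rewrite (big_morph (@hcls0 F V d) (@hcls0D F V d) hcls00).
by apply: eq_bigr => j _; rewrite hcls0Z.
Qed.

(** Linear independence modulo the image and spanning of the kernel modulo the
    image, both stated upstairs, so that the quotient can be forgotten. *)
Lemma homology_basis (J : finType) (b : J -> V) (hb : forall j, d (b j) = 0) :
    (forall c z, \sum_j c j *: b j = d z -> forall j, c j = 0) ->
    (forall x, d x = 0 -> exists c z, x - \sum_j c j *: b j = d z) ->
  is_basis (fun j => hcls (hb j)).
Proof.
have cycle c : d (\sum_j c j *: b j) = 0.
  by rewrite linear_sum big1 // => j _; rewrite linearZ_LR hb scaler0.
move=> free span; split=> [c|]; last first.
  elim/hcls_ind=> x hx; have [c [z e]] := span x hx.
  by exists c; rewrite /= -(hcls_sum hb (cycle c)); apply/hcls_eq; exists z.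
have z0 : 0 = hcls (linear0 d) by rewrite -hcls00; congr hcls0; apply: val_inj.
rewrite /= -(hcls_sum hb (cycle c)) {1}z0 => /hcls_eq[z]; rewrite subr0.
exact: free.
Qed.

End HomologyBasis.

(** * The Dirac operator and the action of K on a tensor product *)

Section DiracSpin.
Variables (F : fieldType) (q : F) (M : algModule (Uq_rel q)).

(** [E (x) c(F_0)] only sees the [s_p1] component and [F (x) c(E_0)] only the
    [s_m1] component, the other one being killed by the Clifford generator. *)
Lemma DiracOpE (x : MS M) :
  DiracOp x = tenS M (act M (gE q) (x true)) s_m1
            + tenS M (act M (gF q) (x false)) s_p1.
Proof.
rewrite /DiracOp {1}(tenS_sum x) big_bool linearD /= !actDl !MSModuleE.
rewrite !act_gen /= !ffunE /= !(scale0r, scale1r) /=.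
by rewrite !linear0 addr0 add0r.
Qed.

Lemma DiracOp_m1 (x : MS M) : DiracOp x false = act M (gE q) (x true).
Proof. by rewrite DiracOpE !ffunE /= scale1r scale0r addr0. Qed.

Lemma DiracOp_p1 (x : MS M) : DiracOp x true = act M (gF q) (x false).
Proof. by rewrite DiracOpE !ffunE /= scale1r scale0r add0r. Qed.

Lemma alphaK_m1 : act (spinModule F) (alphaK q) s_m1 = q^-1 *: s_m1.
Proof.
rewrite /alphaK actDl !actZl act1 actM !act_gen /= !ffunE /=.
by rewrite !scale0r scaler0 addr0.
Qed.

Lemma alphaK_p1 : act (spinModule F) (alphaK q) s_p1 = q *: s_p1.
Proof.
rewrite /alphaK actDl !actZl act1 actM !act_gen /= !ffunE /=.
by rewrite !scale1r -scalerDl addrC subrK.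
Qed.

Lemma deltaK_eigen (q0 : q != 0) m s a b :
    act M (gK q) m = a *: m ->
    act (spinModule F) (alphaK q) s = b *: s ->
  act (MSModule M) (delta q (gen (@Uk_rel F) kK)) (tenS M m s)
    = (a * b) *: tenS M m s.
Proof.
move=> ha hb; rewrite deltaK // MSModuleE ha hb linearZ_LR.
by apply/ffunP=> i; rewrite !ffunE !scalerA mulrC mulrA.
Qed.

(** The action on cohomology is computed on representatives, and [delta K] is
    the pure tensor of [K] and [alphaK], so the eigenvalues multiply. *)
Lemma HD_K_eigen (q0 : q != 0) m s a b (h : DiracOp (tenS M m s) = 0) :
    act M (gK q) m = a *: m ->
    act (spinModule F) (alphaK q) s = b *: s ->
  act (HD q0 M) (gen (@Uk_rel F) kK) (hcls h) = (a * b) *: (hcls h : HD q0 M).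
Proof.
move=> ha hb; have e := deltaK_eigen q0 ha hb.
have h' : DiracOp ((a * b) *: tenS M m s) = 0 by exact: cycleZ h.
have h2 : DiracOp (act (MSModule M) (delta q (gen (@Uk_rel F) kK)) (tenS M m s)) = 0.
  by rewrite e.
rewrite (act_HD q0 h h2) -(hclsZ h h').
by apply/hcls_eq; exists 0; rewrite e subrr linear0.
Qed.

End DiracSpin.

(** * Kernels and images of the raising and lowering operators *)

Section WeightVectors.
Variables (C : numClosedFieldType) (q w : C) (n : nat).

(** The shift [E] never reaches the lowest weight: there is no [i >= 0] with
    [i + 1 = 0]. *)
Lemma Top_uE_low (x : Tspace C n) : Top q w uE x ord0 0 = 0.
Proof.
rewrite /Top summxE big1 // => i _; rewrite !mxE.
by case: eqP => [/=|_]; [lia | rewrite !mulr0].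
Qed.

Lemma Top_uF_high (x : Tspace C n) : Top q w uF x ord_max 0 = 0.
Proof.
rewrite /Top summxE big1 // => i _; rewrite !mxE.
case: eqP => [/=|_]; last by rewrite !mulr0.
by have := ltn_ord i; lia.
Qed.

Lemma Top_uE_up (x : Tspace C n) (i j : 'I_n.+1) : j = i.+1 :> nat ->
  Top q w uE x j 0 = x i 0 * sqrtC (qnum q (n%:Z - i%:Z) * qnum q (i%:Z + 1)).
Proof.
move=> ji; rewrite /Top summxE (bigD1 i) //= big1 => [|k ki]; rewrite !mxE.
  by rewrite (introT eqP _ : j%:Z == i%:Z + 1) ?mulr1 ?addr0 ?mulrA //; lia.
case: eqP => [e|_]; last by rewrite !mulr0.
by case/eqP: ki; apply: val_inj => /=; lia.
Qed.

Lemma Top_uF_down (x : Tspace C n) (i j : 'I_n.+1) : i = j.+1 :> nat ->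
  Top q w uF x j 0
    = x i 0 * (w * sqrtC (qnum q i%:Z * qnum q (n%:Z - i%:Z + 1))).
Proof.
move=> ij; rewrite /Top summxE (bigD1 i) //= big1 => [|k ki]; rewrite !mxE.
  by rewrite (introT eqP _ : j%:Z == i%:Z - 1) ?mulr1 ?addr0 ?mulrA //; lia.
case: eqP => [e|_]; last by rewrite !mulr0.
by case/eqP: ki; apply: val_inj => /=; lia.
Qed.

Hypothesis q0 : q != 0.
Hypothesis hq : forall j : nat, (0 < j)%N -> q ^+ j != 1.

(** [q ^ j = q ^ (- j)] with [j != 0] would give [q ^ (2 * j) = 1]. This is used
    for the numerator, with [j = i], and for the denominator, with [j = 1]. *)
Lemma qnum_neq0 (i : int) : i != 0 -> qnum q i != 0.
Proof.
move=> i0.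
have pos (m : nat) : (0 < m)%N -> q ^+ m != q ^- m.
  move=> m0; apply/eqP => e; have /eqP := @hq (m + m)%N ltac:(lia).
  by apply; rewrite exprD {2}e mulfV // expf_neq0.
have nz (j : int) : j != 0 -> q ^ j - q ^ (- j) != 0.
  case: (intP j) => // m _; rewrite subr_eq0.
    by rewrite -exprnN -exprnP pos.
  by rewrite opprK -exprnN -exprnP eq_sym pos.
by rewrite mulf_neq0 ?nz // invr_eq0 (nz 1).
Qed.

(** The coordinate of [E x] at [i + 1] is a nonzero multiple of that of [x] at
    [i] as long as [i < n], so every coordinate of [x] but the last one is
    zero. *)
Lemma Top_uE_ker (x : Tspace C n) : Top q w uE x = 0 ->
  x = x ord_max 0 *: Tv n n%:Z.
Proof.
move=> Ex; apply/colP=> i; rewrite !mxE.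
case: eqP => [[e]|ne]; first by rewrite mulr1; congr (x _ _); apply: val_inj.
have lt_i : (i.+1 < n.+1)%N by have := ltn_ord i; lia.
have := @Top_uE_up x i (Ordinal lt_i) erefl.
rewrite Ex mxE mulr0 => /esym/eqP; rewrite mulf_eq0 => /orP[/eqP //|].
by rewrite sqrtC_eq0 mulf_eq0 !(negPf (qnum_neq0 _)) //; lia.
Qed.

Lemma Top_uF_ker (x : Tspace C n) : w != 0 -> Top q w uF x = 0 ->
  x = x ord0 0 *: Tv n 0.
Proof.
move=> w0 Fx; apply/colP=> i; rewrite !mxE.
case: eqP => [[e]|ne]; first by rewrite mulr1; congr (x _ _); apply: val_inj.
have lt_i : (i.-1 < n.+1)%N by have := ltn_ord i; lia.
have := @Top_uF_down x i (Ordinal lt_i) ltac:(rewrite /=; lia).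
rewrite Fx mxE mulr0 => /esym/eqP; rewrite mulf_eq0 => /orP[/eqP //|].
have i_le := ltn_ord i.
by rewrite mulf_eq0 (negPf w0) sqrtC_eq0 mulf_eq0 !(negPf (qnum_neq0 _)) //; lia.
Qed.

End WeightVectors.

(** * The Dirac cohomology of the irreducible modules *)

Theorem theorem4p3 (R : realType) (q : R[i]) (q0 : q != 0)
    (hq : forall j : nat, (0 < j)%N -> q ^+ j != 1)
    (w : R[i]) (hw : w = 1 \/ w = -1) (n : nat) :
  let M := Tmodule n q0 hw in
  let lo : MS M := tenS M (Tv n 0) s_m1 in
  let hi : MS M := tenS M (Tv n n%:Z) s_p1 in
  exists (hlo : DiracOp lo = 0) (hhi : DiracOp hi = 0),
    let clo : HD q0 M := hcls hlo in
    let chi : HD q0 M := hcls hhi in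
    [/\ is_basis (fun b : bool => if b then chi else clo),
        act (HD q0 M) (gen (@Uk_rel R[i]) kK) clo = (w * q ^ (- n%:Z - 1)) *: clo
      & act (HD q0 M) (gen (@Uk_rel R[i]) kK) chi = (w * q ^ (n%:Z + 1)) *: chi].
Proof.
move=> M lo hi.
have w0 : w != 0 by case: (hw) => ->; rewrite ?oppr_eq0 oner_eq0.
have actE g x : act M (gen (Uq_rel q) g) x = Top q w g x by exact: act_gen.
(* The outermost weights of the shifts contain the factor [0] = 0. *)
have hlo : DiracOp lo = 0.
  rewrite DiracOpE !ffunE /= scale0r scale1r linear0 TmoduleE /=.
  by rewrite qnum0 mul0r sqrtC0 mulr0 scale0r;
     apply/ffunP=> b; rewrite !ffunE !scaler0 addr0.
have hhi : DiracOp hi = 0.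
  rewrite DiracOpE !ffunE /= scale0r scale1r linear0 TmoduleE /=.
  by rewrite subrr qnum0 mul0r sqrtC0 scale0r;
     apply/ffunP=> b; rewrite !ffunE !scaler0 addr0.
exists hlo, hhi => clo chi; split; last first.
- have Khi : act M (gK q) (Tv n n%:Z) = (w * q ^ n%:Z) *: Tv n n%:Z.
    by rewrite TmoduleE /=; congr ((_ * q ^ _) *: _); lia.
  rewrite (HD_K_eigen q0 hhi Khi (alphaK_p1 q)) -mulrA.
  by rewrite expfzDr // expr1z.
- have Klo : act M (gK q) (Tv n 0) = (w * q ^ (- n%:Z)) *: Tv n 0.
    by rewrite TmoduleE /= mulr0 sub0r.
  rewrite (HD_K_eigen q0 hlo Klo (alphaK_m1 q)) -mulrA.
  by rewrite expfzDr // exprN1.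
pose b (e : bool) : MS M := if e then hi else lo.
have hb e : DiracOp (b e) = 0 by case: e.
have sum_b (c : bool -> R[i]) (e : bool) :
    (\sum_e c e *: b e) e = c e *: Tv n (if e then n%:Z else 0).
  rewrite big_bool; case: e; rewrite !ffunE /= scale1r scale0r scaler0.
    by rewrite addr0.
  by rewrite add0r.
have -> : (fun e : bool => if e then chi else clo) = (fun e => hcls (hb e)).
  by apply: funext => -[]; congr hcls0; apply: val_inj.
apply: homology_basis => [c z e [] | x Dx].
- (* A boundary has no coordinate on the extremal vectors themselves. *)
  have := congr1 (fun y : MS M => (y true : Tspace _ n) ord_max 0) e.
  by rewrite sum_b [DiracOp z true]DiracOp_p1 actE Top_uF_high !mxE eqxx mulr1.
- have := congr1 (fun y : MS M => (y false : Tspace _ n) ord0 0) e.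
  by rewrite sum_b [DiracOp z false]DiracOp_m1 actE Top_uE_low !mxE eqxx mulr1.
(* A cycle is equal to a combination of [lo] and [hi], without correction by a
   boundary. *)
have := congr1 (fun y : MS M => y true) Dx.
have := congr1 (fun y : MS M => y false) Dx.
rewrite [DiracOp x true]DiracOp_p1 [DiracOp x false]DiracOp_m1 !actE !ffunE.
move=> Ex Fx.
exists (fun e => (x e : Tspace _ n) (if e then ord_max else ord0) 0), 0.
rewrite linear0; apply/eqP; rewrite subr_eq0; apply/eqP/ffunP=> -[].
- by rewrite sum_b; exact: (Top_uE_ker q0 hq Ex).
- by rewrite sum_b; exact: (Top_uF_ker q0 hq w0 Fx).
Qed.
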